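(* Let $p(y)$ be a probability density on $\mathbf{R}_+$ such that $p(y)=y^{-1-\alpha}$ for $y\ge B$, with some $\alpha\in(0,1)$ and $B>0$. Let $h>0$. Then for any continuous $f$ on $\mathbf{R}_+$ such that $f(0)=f(\infty)=0$ and $f$ is Lipschitz at zero in the sense that $|f(y)|\le Ly$ for $y\in[0,Bh]$ and some constant $L$, it follows that $$\left|h^{-\alpha}\int_0^\infty f(hy)p(y)\,dy-\int_0^\infty\frac{f(y)\,dy}{y^{1+\alpha}}\right|\le C_BLh^{1-\alpha},$$ with $$C_B=\frac{B^{1-\alpha}}{1-\alpha}+\int_0^B y\,p(y)\,dy.$$
   Context: $\mathbf{R}_+=[0,\infty)$, and $f(\infty)=0$ means $\lim_{y\to\infty}f(y)=0$. *)

(* Defs.v *)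
From HB Require Import structures.
From mathcomp Require Export all_boot all_order all_algebra.
From mathcomp Require Export all_classical all_reals all_analysis.
Export Order.TTheory GRing.Theory Num.Theory.
Export numFieldNormedType.Exports.

#[export] Set Implicit Arguments.
#[export] Unset Strict Implicit.
#[export] Unset Printing Implicit Defensive.

#[global] Open Scope classical_set_scope.
#[global] Open Scope ring_scope.

(* Functions on R_+ = [0, +oo[ are represented by functions R -> R whose
   values on the negative reals are irrelevant. *)
Definition probability_density_Rplus (R : realType) (p : R -> R) : Prop :=
  [/\ measurable_fun (`[0, +oo[ : set R) p,
      forall y : R, 0 <= y -> 0 <= p y &
      (\int[@lebesgue_measure R]_(y in `[0%R, +oo[) (p y)%:E = 1)%E].

(* The second summand is a real-valued integral: for a probability density p
   it is at most B, so no infinite value is lost. *)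
Definition C_ (R : realType) (alpha : R) (p : R -> R) (B : R) : R :=
  B `^ (1 - alpha) / (1 - alpha)
  + \int[@lebesgue_measure R]_(y in `[0, B]) (y * p y).

(* Main.v *)
Require Import Defs.
From mathcomp Require Import measurable_realfun ring.

(* Split the first integral at [B] and the second one at [h * B]. Since [p] is
   a pure power beyond [B], the substitution [y -> h * y] shows that the two
   tails, the first one multiplied by [h `^ (- alpha)], are equal; they are
   finite because [f] is bounded and [p] is integrable, so they cancel. The two
   heads are bounded separately by the Lipschitz condition and give the two
   summands of [C_]. *)

(** Disjointification turns the integral over the union into a series of nonnegative terms. Its n-th
    partial sum is an integral over a subset of [F n], hence at most [c]. *)
Lemma ge0_integral_bigcup_le d (T : measurableType d) (R : realType)
    (mu : {measure set T -> \bar R}) (F : (set T)^nat) (f : T -> \bar R)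
    (c : \bar R) :
  (forall n, measurable (F n)) -> nondecreasing_seq F ->
  measurable_fun (\bigcup_n F n) f ->
  (forall x, (\bigcup_n F n) x -> (0 <= f x)%E) ->
  (forall n, (\int[mu]_(x in F n) f x <= c)%E) ->
  (\int[mu]_(x in \bigcup_n F n) f x <= c)%E.
Proof.
move=> mF ndF mf f0 Fc.
have mD n : measurable (seqDU F n).
  by apply: measurableD => //; exact: bigsetU_measurable.
have subF n : \big[setU/set0]_(i < n) seqDU F i `<=` F n.
  rewrite -bigsetU_seqDU -bigcup_mkord => x [i /= /ltnW /ndF /subsetPset Fin].
  exact: Fin.
rewrite seqDU_bigcup_eq ge0_integral_bigcup//; rewrite -?seqDU_bigcup_eq//.
apply: lime_le.
  apply: is_cvg_nneseries => n _ _; apply: integral_ge0 => x Dx.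
  by apply: f0; exists n => //; exact: subset_seqDU Dx.
apply: nearW => n; rewrite big_mkord; apply: le_trans (Fc n).
have subU n' : F n' `<=` \bigcup_k F k by move=> x ?; exists n'.
rewrite -(big_mkord xpredT (fun i => \int[mu]_(x in seqDU F i) f x)%E).
rewrite -ge0_integral_bigsetU//=; rewrite ?big_mkord; last 4 first.
- exact: iota_uniq.
- exact: sub_trivIset (@subsetT _ _) (@trivIset_seqDU _ F).
- apply: measurable_funS mf; first exact: bigcupT_measurable.
  exact: subset_trans (subF n) (subU n).
- by move=> x /subF ?; apply: f0; exists n.
apply: ge0_subset_integral => //.
- exact: bigsetU_measurable.
- apply: measurable_funS mf => //; exact: bigcupT_measurable.
- by move=> x ?; apply: f0; exists n.
Qed.

Lemma within_continuous_powR (R : realType) (a r : R) (D : set R) :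
  0 < a -> (forall x, D x -> a <= x) -> {within D, continuous (fun x : R => x `^ r)}.
Proof.
move=> a0 Da.
apply/continuous_in_subspaceT => x /set_mem /Da ax.
have x0 : 0 < x by exact: lt_le_trans ax.
apply/differentiable_continuous/derivable1_diffP.
by apply: derivable_powR; rewrite in_itv/= x0.
Qed.

(* The integrand is unbounded near [0], so the fundamental theorem of calculus
   is applied on [`[b / n.+2, b]], uniformly in [n]. *)
Lemma integral_powRN_le (R : realType) (a b : R) : 0 < a < 1 -> 0 < b ->
  (\int[@lebesgue_measure R]_(y in `[0%R, b]) (y `^ (- a))%:E
   <= (b `^ (1 - a) / (1 - a))%:E)%E.
Proof.
move=> /andP[a0 a1] b0.
have mpow (D : set R) : measurable_fun D (fun y : R => (y `^ (- a))%:E).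
  by apply/measurable_funTS/measurable_EFinP; exact: measurable_powR.
have a1' : 1 - a != 0 by rewrite gt_eqF// subr_gt0.
(* The null set {0} is dropped, since the intervals [F n] exhaust only the half-open interval. *)
rewrite -integral_itv_obnd_cbnd//.
(* With [n.+2] the left endpoint is strictly below [b] already for n = 0, as the fundamental theorem
   of calculus requires. *)
pose F n := [set` `[b / n.+2%:R, b]] : set R.
have ndF : nondecreasing_seq F.
  move=> m n mn; apply/subsetPset => x; rewrite /F/= !in_itv/= => /andP[h ->].
  rewrite andbT (le_trans _ h)// ler_pM2l// lef_pV2 ?posrE ?ltr0n//.
  by rewrite ler_nat !ltnS.
have -> : `]0, b]%classic = \bigcup_n F n.
  apply/seteqP; split => x /=; rewrite /F/= ?in_itv/=.
    move=> /andP[x0 xb].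
    have [n _ /(_ n (leqnn _))] := near_infty_natSinv_lt (PosNum (divr_gt0 x0 b0)).
    rewrite /= => nx; exists n => //=; rewrite in_itv/= xb andbT.
    rewrite mulrC -ler_pdivlMr// (le_trans _ (ltW nx))//.
    by rewrite lef_pV2 ?posrE ?ltr0n// ler_nat.
  move=> [n _ /=]; rewrite in_itv/= => /andP[h ->]; rewrite andbT.
  by apply: lt_le_trans h; rewrite divr_gt0.
apply: ge0_integral_bigcup_le => //.
- by move=> n; exact: measurable_itv.
- exact: mpow.
- by move=> x _; rewrite lee_fin powR_ge0.
move=> n.
have c0 : 0 < b / n.+2%:R by rewrite divr_gt0.
have derG (x : R) : 0 < x ->
    is_derive x 1 (fun x : R => x `^ (1 - a) / (1 - a)) (x `^ (- a)).
  move=> x0; rewrite [X in is_derive _ _ X _](_ : _ =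
    (1 - a)^-1 \*: (fun x : R => x `^ (1 - a))); last first.
    by apply/funext => y /=; rewrite mulrC.
  apply: is_derive_eq.
    by apply: is_deriveZ; exact: is_derive1_powR.
  by rewrite /GRing.scale/= mulrA mulVf// mul1r; congr (_ `^ _); ring.
have cG (x : R) : 0 < x -> {for x, continuous (fun x : R => x `^ (1 - a) / (1 - a))}.
  move=> x0; have [+ _] := derG x x0.
  by move=> /derivable1_diffP/differentiable_continuous.
rewrite (@continuous_FTC2 _ _ (fun x => x `^ (1 - a) / (1 - a))) //.
(* The antiderivative is nonnegative at the left endpoint; dropping its value there leaves a bound
   free of [n]. *)
- rewrite -EFinB lee_fin gerBl// divr_ge0 ?powR_ge0// subr_ge0 ltW//.
- by rewrite ltr_pdivrMr// ltr_pMr// ltr1n.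
- by apply: (within_continuous_powR c0) => x; rewrite /= in_itv/= => /andP[].
- split.
  + move=> x; rewrite in_itv/= => /andP[h _].
    by have [] := derG x (lt_trans c0 h).
  + by apply: cvg_at_right_filter; exact: cG.
  + by apply: cvg_at_left_filter; exact: cG.
- move=> x; rewrite in_itv/= => /andP[h _].
  by have [_] := derG x (lt_trans c0 h); rewrite derive1E.
Qed.

(** Beyond some [N] the function is within 1 of its limit, and up to [N] compactness applies. *)
Lemma bounded_within_itvcy (R : realType) (a : R) (f : R -> R) (l : R) :
  {within `[a, +oo[, continuous f} -> f y @[y --> +oo] --> l ->
  exists M, forall y, a <= y -> `|f y| <= M.
Proof.
move=> cf fl.
have [N [_ fN]] : \forall y \near +oo, `|l - f y| <= 1.
  by move/cvgrPdist_le : fl; apply.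
have cab : {within `[a, N], continuous f}.
  by apply: continuous_subspaceW cf; exact: subset_itvl.
have [M [_ fM]] := compact_bounded (continuous_compact cab (@segment_compact R a N)).
(* Compactness gives a bound by every number strictly above [M], whence M + 1. *)
exists (Num.max (M + 1) (`|l| + 1)) => y ay; rewrite le_max.
have [yN|Ny] := leP y N; apply/orP; [left|right].
  by apply: fM; [rewrite ltrDl|exists y => //=; rewrite in_itv/= ay yN].
rewrite -lerBlDl; apply: le_trans (fN _ Ny).
by rewrite distrC lerB_dist.
Qed.

(** * Change of scale on a half-line *)

Lemma ge0_integral_itvcy_scale (R : realType) (G : R -> R) (a h : R) :
  0 < h -> {within `[h * a, +oo[, continuous G} ->
  (forall x, h * a <= x -> 0 <= G x) ->
  (\int[@lebesgue_measure R]_(x in `[(h * a)%R, +oo[) (G x)%:E =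
   \int[@lebesgue_measure R]_(x in `[a, +oo[) (h * G (h * x))%R%:E)%E.
Proof.
move=> h0 cG G0.
have dF (x : R) : is_derive x 1 (fun x : R => h * x) h.
  have /is_derive_eq := is_deriveZ h (is_derive_id x (1 : R)).
  by apply; rewrite /GRing.scale/= mulr1.
have F' : (fun x : R => h * x)^`()%classic = cst h.
  by apply/funext => x; rewrite derive1E; exact: derive_val.
rewrite (increasing_ge0_integration_by_substitutiony (F := fun x => h * x)).
- by apply: eq_integral => x _; rewrite F' /= mulrC.
- by move=> x y _ _ xy; rewrite ltr_pM2l.
- by rewrite F' => x _; exact: cst_continuous.
- by rewrite F'; exact: is_cvg_cst.
- by rewrite F'; exact: is_cvg_cst.
- split; first by move=> x _; have [] := dF x.
  by apply: cvg_at_right_filter; exact: mulrl_continuous.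
- by apply: gt0_cvgMry => //; exact: cvg_id.
- exact: cG.
- by move=> x; rewrite in_itv/= andbT => /ltW; exact: G0.
Qed.

(** The nonnegative case applies to the positive and negative parts of [G], which are continuous.
    Multiplication by h > 0 commutes with taking parts, so the two sides agree part by part,
    infinite values included. *)
Lemma integral_itvcy_scale (R : realType) (G : R -> R) (a h : R) :
  0 < h -> {within `[h * a, +oo[, continuous G} ->
  (\int[@lebesgue_measure R]_(x in `[(h * a)%R, +oo[) (G x)%:E =
   \int[@lebesgue_measure R]_(x in `[a, +oo[) (h * G (h * x))%R%:E)%E.
Proof.
move=> h0 cG.
have cpos (u : R -> R) : {within `[h * a, +oo[, continuous u} ->
    {within `[h * a, +oo[, continuous u^\+}.
  move=> cu; apply: (@within_continuous_comp _ _ _ _ u (fun y => Num.max y 0)) => //.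
  move=> y _; apply: (@continuous_max _ _ id (cst 0)).
    exact: cvg_id.
  exact: cvg_cst.
rewrite integralE [RHS]integralE; congr (_ - _)%E.
  transitivity (\int[@lebesgue_measure R]_(x in `[(h * a)%R, +oo[) (G^\+ x)%:E)%E.
    by apply: eq_integral => x _; rewrite funerpos.
  rewrite ge0_integral_itvcy_scale//; last exact: cpos.
  apply: eq_integral => x _; rewrite (funerpos (fun x => h * G (h * x)))/=.
  by rewrite (ge0_funrposM (fun x => G (h * x)) (ltW h0)).
transitivity (\int[@lebesgue_measure R]_(x in `[(h * a)%R, +oo[) (G^\- x)%:E)%E.
  by apply: eq_integral => x _; rewrite funerneg.
rewrite ge0_integral_itvcy_scale//; last first.
  (* The negative part of [G] is the positive part of its opposite. *)
  rewrite -funrposN; apply: cpos => x; apply: continuousN; exact: cG.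
apply: eq_integral => x _; rewrite (funerneg (fun x => h * G (h * x)))/=.
by rewrite (ge0_funrnegM (fun x => G (h * x)) (ltW h0)).
Qed.

(* The integrals on the left-hand side are extended-real valued. Since
   [+oo - +oo], and likewise the integral of a function whose positive and
   negative parts both have infinite integral, evaluates to [-oo], the finite
   bound also entails that both integrals converge absolutely. *)
Theorem proposition5p1 (R : realType) (alpha B h : R) (p : R -> R)
    (halpha : 0 < alpha < 1) (hB : 0 < B) (hh : 0 < h)
    (hp : probability_density_Rplus p)
    (hpB : forall y : R, B <= y -> p y = y `^ (- 1 - alpha))
    (f : R -> R) (L : R)
    (fcont : {within `[0, +oo[, continuous f})
    (f0 : f 0 = 0)
    (foo : f y @[y --> +oo] --> 0)
    (fLip : forall y : R, 0 <= y <= B * h -> `|f y| <= L * y) :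
  (`| (h `^ (- alpha))%:E
        * \int[@lebesgue_measure R]_(y in `[0%R, +oo[) (f (h * y) * p y)%:E
      - \int[@lebesgue_measure R]_(y in `[0%R, +oo[) (f y / y `^ (1 + alpha))%:E |
    <= (C_ alpha p B * L * h `^ (1 - alpha))%:E)%E.
Proof.
have [mp p0 ip] := hp.
pose mu := @lebesgue_measure R.
have hB0 : 0 < h * B by rewrite mulr_gt0.
(* The Lipschitz bound at the positive point B * h forces the sign of [L]. *)
have L0 : 0 <= L.
  have := fLip (B * h); rewrite lexx mulrC (ltW hB0) => /(_ isT).
  by move=> /(le_trans (normr_ge0 _)); rewrite pmulr_lge0.
have [M fM] := bounded_within_itvcy fcont foo.
have mf : measurable_fun (`[0, +oo[ : set R) f.
  by apply: subspace_continuous_measurable_fun.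
have mfh : measurable_fun (`[0, +oo[ : set R) (fun y => f (h * y)).
  refine (measurable_comp (f := f) (g := *%R h) _ _ mf _) => //.
  by move=> _ [y /= + <-]; rewrite !in_itv/= !andbT => /(mulr_ge0 (ltW hh)).
pose Fp y := f (h * y) * p y.
pose G y := f y / y `^ (1 + alpha).
have mFp : measurable_fun (`[0, +oo[ : set R) Fp by exact: measurable_funM.
have mG : measurable_fun (`[0, +oo[ : set R) G.
  apply: measurable_funM => //; apply: measurable_funTS.
  rewrite [X in measurable_fun _ X](_ : _ = (fun y : R => y `^ (- (1 + alpha)))).
    exact: measurable_powR.
  by apply/funext => y; rewrite powRN.
have split_at (b : R) (u : R -> R) : 0 < b ->
    measurable_fun (`[0, +oo[ : set R) u ->
    (\int[mu]_(y in `[0%R, +oo[) (u y)%:E =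
     \int[mu]_(y in `[0%R, b]) (u y)%:E + \int[mu]_(y in `[b, +oo[) (u y)%:E)%E.
  move=> b0 muu.
  have mu_ (i : interval R) : [set` i] `<=` (`[0, +oo[ : set R) ->
      measurable_fun [set` i] (fun y => (u y)%:E).
    by move=> i0; apply/measurable_EFinP; exact: measurable_funS muu.
  (* The point [b], a null set, is removed from the right piece to make the two pieces disjoint. *)
  rewrite -[X in (_ + X)%E]integral_itv_obnd_cbnd; last first.
    by apply: mu_; apply: subset_itvr; rewrite bnd_simp ltW.
  rewrite -integral_setU//.
  - by rewrite -itv_bndbnd_setU// bnd_simp// ltW.
  - by rewrite -itv_bndbnd_setU ?bnd_simp// ?ltW//; exact: mu_.
  - apply/disj_set2P; apply/seteqP; split=> // y /=.
    by rewrite !in_itv/= andbT => -[/andP[_]]; rewrite leNgt => /negP.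
have intp : mu.-integrable (`[0, +oo[ : set R) (EFin \o p).
  apply/integrableP; split; first exact/measurable_EFinP.
  apply: (@le_lt_trans _ _ 1%E); last by rewrite ltry.
  rewrite -ip le_eqVlt; apply/orP; left; apply/eqP.
  apply: eq_integral => y; rewrite inE/= in_itv/= andbT => y0.
  by rewrite ger0_norm ?p0.
(* Domination by [M] times the density [p]. *)
have intFp : mu.-integrable (`[0, +oo[ : set R) (EFin \o Fp).
  have intMp : mu.-integrable (`[0, +oo[ : set R) (fun y => M%:E * (p y)%:E)%E.
    exact: integrableZl.
  apply: le_integrable intMp => //.
  - exact/measurable_EFinP.
  - move=> y; rewrite /= in_itv/= andbT => y0.
    rewrite lee_fin !normrM ler_wpM2r//.
    by apply: le_trans (ler_norm M); apply: fM; rewrite mulr_ge0// ltW.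
have intS (i : interval R) (u : R -> \bar R) : [set` i] `<=` (`[0, +oo[ : set R) ->
    mu.-integrable (`[0, +oo[ : set R) u -> mu.-integrable [set` i] u.
  by move=> i0; apply: integrableS.
have s0B : [set` `[0, B]] `<=` (`[0, +oo[ : set R) by exact: subset_itvl.
have sB : [set` `[B, +oo[] `<=` (`[0, +oo[ : set R).
  by apply: subset_itvr; rewrite bnd_simp ltW.
have s0hB : [set` `[0, h * B]] `<=` (`[0, +oo[ : set R) by exact: subset_itvl.
have shB : [set` `[h * B, +oo[] `<=` (`[0, +oo[ : set R).
  by apply: subset_itvr; rewrite bnd_simp ltW.

(* Equality of the tails *)
pose c := h `^ (- alpha).
have tail : (\int[mu]_(y in `[(h * B)%R, +oo[) (G y)%:E =
             c%:E * \int[mu]_(y in `[B, +oo[) (Fp y)%:E)%E.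
  rewrite -integralZl//; last exact: intS.
  rewrite integral_itvcy_scale//.
    (* For y >= B the integrands agree pointwise: h * G (h * y) = h^(-alpha) * f (h * y) *
       y^(-1-alpha). *)
    apply: eq_integral => y; rewrite inE/= in_itv/= andbT => By.
    have y0 : 0 < y by exact: lt_le_trans By.
    rewrite -EFinM; congr EFin; rewrite /G /Fp hpB// /c.
    rewrite powRM ?(ltW hh) ?(ltW y0)// -opprD !powRN.
    rewrite (powRD (x := h)); last by rewrite (gt_eqF hh) implybT.
    rewrite powRr1 ?ltW//; field.
    by rewrite !gt_eqF ?powR_gt0.
  have cf := continuous_subspaceW shB fcont.
  have cpow : {within `[h * B, +oo[, continuous (fun y => (y `^ (1 + alpha))^-1)}.
    rewrite [X in continuous X](_ : _ = (fun y => y `^ (- (1 + alpha)))).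
      by apply: (within_continuous_powR hB0) => x /=; rewrite in_itv/= andbT.
    by apply/funext => x; rewrite powRN.
  by move=> y; exact: (continuousM (cf y) (cpow y)).

(* Bounds for the heads *)
pose K := \int[mu]_(y in `[0, B]) (y * p y).
(* Domination by B * p y; this identifies [K] with the extended-real integral. *)
have intyp : mu.-integrable (`[0, B] : set R) (fun y => (y * p y)%:E).
  have intBp : mu.-integrable (`[0, B] : set R) (fun y => B%:E * (p y)%:E)%E.
    by apply: integrableZl => //; exact: intS.
  apply: le_integrable intBp => //.
  - apply/measurable_EFinP/measurable_funM => //.
    exact: measurable_funS mp.
  - move=> y; rewrite /= in_itv/= => /andP[y0 yB].
    by rewrite lee_fin !normrM ler_wpM2r// !ger0_norm// ltW.
have headF : (`|\int[mu]_(y in `[0%R, B]) (Fp y)%:E| <= (L * h * K)%:E)%E.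
  have mFpB : measurable_fun (`[0, B] : set R) (EFin \o Fp).
    by apply/measurable_EFinP; exact: measurable_funS mFp.
  apply: (le_trans (le_abse_integral mu (measurable_itv _) mFpB)).
  rewrite EFinM /K /Rintegral fineK; last exact: integrable_fin_num.
  rewrite -integralZl//; apply: ge0_le_integral => //.
  - exact: measurableT_comp.
  - by apply: measurable_funeM; exact: measurable_int intyp.
  - move=> y; rewrite /= in_itv/= => /andP[y0 yB].
    rewrite lee_fin normrM (ger0_norm (p0 _ _))// !mulrA ler_wpM2r ?p0//.
    rewrite -mulrA; apply: fLip.
    by rewrite (mulr_ge0 (ltW hh) y0)/= mulrC ler_pM2r.
have headG : (`|\int[mu]_(y in `[0%R, (h * B)%R]) (G y)%:E| <=
    (L * ((h * B) `^ (1 - alpha) / (1 - alpha)))%:E)%E.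
  have mGB : measurable_fun (`[0, h * B] : set R) (EFin \o G).
    by apply/measurable_EFinP; exact: measurable_funS mG.
  have mpow : measurable_fun (`[0, h * B] : set R) (fun y : R => (y `^ (- alpha))%:E).
    by apply/measurable_funTS/measurable_EFinP; exact: measurable_powR.
  apply: (le_trans (le_abse_integral mu (measurable_itv _) mGB)).
  rewrite EFinM; apply: (@le_trans _ _
    (L%:E * \int[mu]_(y in `[0%R, (h * B)%R]) (y `^ (- alpha))%:E)%E); last first.
    by apply: lee_wpmul2l; rewrite ?lee_fin//; exact: integral_powRN_le.
  rewrite -ge0_integralZl_EFin//; last by move=> y _; rewrite lee_fin powR_ge0.
  apply: ge0_le_integral => //.
  - exact: measurableT_comp.
  - exact: measurable_funeM.
  - move=> y; rewrite /= in_itv/= => /andP[y0 yB].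
    rewrite lee_fin normrM normfV (ger0_norm (powR_ge0 _ _)).
    (* The exponent law used below needs y <> 0; at the origin f 0 = 0 makes the left side
       vanish. *)
    have [->|yn0] := eqVneq y 0.
      by rewrite f0 normr0 mul0r mulr_ge0 ?powR_ge0.
    have y_gt0 : 0 < y by rewrite lt_neqAle eq_sym yn0.
    rewrite powRD; last by rewrite yn0 implybT.
    rewrite powRr1// powRN ler_pdivrMr ?mulr_gt0 ?powR_gt0//.
    rewrite [leRHS](_ : _ = L * y); first by apply: fLip; rewrite y0 mulrC.
    by field; rewrite gt_eqF ?powR_gt0.

(* Cancellation and final estimate *)
rewrite (split_at B Fp)// (split_at (h * B) G)// tail.
have fin1 : (\int[mu]_(y in `[0%R, B]) (Fp y)%:E)%E \is a fin_num.
  by rewrite fin_num_abs (le_lt_trans headF) ?ltry.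
have fin2 : (\int[mu]_(y in `[B, +oo[) (Fp y)%:E)%E \is a fin_num.
  by apply: integrable_fin_num => //; exact: intS.
have fin3 : (\int[mu]_(y in `[0%R, (h * B)%R]) (G y)%:E)%E \is a fin_num.
  by rewrite fin_num_abs (le_lt_trans headG) ?ltry.
move: fin1 fin2 fin3 headF headG => /fineK <- /fineK <- /fineK <-.
(* All three integrals are finite, so the computation moves to the reals: [x] and [y] are the heads
   of [Fp] and [G], and [z] is the tail of [Fp]. *)
set x := fine _; set y := fine _; set z := fine _.
rewrite -!(EFinM, EFinD, EFinN) !lee_fin => headF headG.
have c0 : 0 <= c by exact: powR_ge0.
(* Both head bounds carry this factor: h * c comes from [headF] and h^(1-alpha) from [headG]. *)
have hc : h `^ (1 - alpha) = h * c.
  by rewrite powRD ?(gt_eqF hh) ?implybT// powRr1 // ltW.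
rewrite -/c (_ : c * (x + z) - (y + c * z) = c * x - y); last by ring.
apply: le_trans (ler_normB _ _) _; rewrite normrM (ger0_norm c0).
apply: le_trans (lerD (ler_wpM2l c0 headF) headG) _.
rewrite (powRM _ (ltW hh) (ltW hB)) /C_ -/K hc le_eqVlt.
by apply/orP; left; apply/eqP; ring.
Qed.
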